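(* Let $m$ be the number of input quantum states and let $n=m(m-1)/2$. Then there exists a unitary $\mathcal{U}_m$ that maps, for arbitrary unknown input states $|\phi_1\rangle,\dots,|\phi_m\rangle$ (with the normalization of the right-hand side omitted), $$\mathcal{U}_m:\ |0\rangle^{\otimes d_m}\otimes\bigotimes_{i=1}^{m}|\phi_i\rangle\ \longrightarrow\ \sum_{ij=1}^{n}|ij\rangle\,|\phi_i\phi_jG_{ij}\rangle ,$$ where $d_m$ is the number of ancillary qubits, $|ij\rangle$ denotes the basis state of the $d_m$ ancillaries assigned to the state pair $|\phi_i\phi_j\rangle$, and $G_{ij}$ is a garbage state stored in the state registers after the transformation. Moreover, $d_m=O(\ln m)$, and $\mathcal{U}_m$ can be computed by a quantum circuit with $O(m)$ CSWAP gates.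
   Context: There are $m$ state registers, initially carrying the pure quantum states $|\phi_1\rangle,\dots,|\phi_m\rangle$, and $d_m$ ancillary qubits, initially in $|0\rangle$. In the sum, $ij$ is a single index running over the $n=m(m-1)/2$ pairs of distinct input states. In the term labelled $ij$, the states $\phi_i,\phi_j$ occupy the first two state registers and $G_{ij}$ is the content of the remaining state registers. A CSWAP (controlled-swap) gate exchanges the contents of two state registers if its control ancillary qubit is in state $|1\rangle$, and does nothing if the control is in state $|0\rangle$. *)

(* Defs.v *)
From HB Require Import structures.
From mathcomp Require Import all_boot all_order all_algebra.
From mathcomp Require Import perm spectral complex.
From mathcomp Require Import all_classical all_reals all_analysis.
Import Order.TTheory GRing.Theory Num.Theory.
Import numFieldNormedType.Exports.

Set Implicit Arguments.
Unset Strict Implicit.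
Unset Printing Implicit Defensive.

Local Open Scope ring_scope.

(* A Hilbert space with orthonormal basis indexed by the finite type T is
   'cV[R[i]]_#|T|, the coordinate on x : T being the one of index enum_rank x.
   Ancillas: T = anc d (bit strings of length d).
   State registers: T = regs m D (m registers with Hilbert space C^D each). *)
Definition anc (d : nat) : finType := {ffun 'I_d -> 'I_2}.
Definition regs (m D : nat) : finType := {ffun 'I_m -> 'I_D}.
Definition conf (d m D : nat) : finType := (anc d * regs m D)%type.

Section States.
Variable R : realType.
Local Notation C := (R[i]).

Definition normalized (n : nat) (v : 'cV[C]_n) : Prop :=
  \sum_(k < n) `|v k 0| ^+ 2 = 1.

Definition ket (T : finType) (x : T) : 'cV[C]_#|T| := delta_mx (enum_rank x) 0.

Definition tens (S T : finType) (u : 'cV[C]_#|S|) (v : 'cV[C]_#|T|) :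
    'cV[C]_#|{: S * T}| :=
  \col_k (u (enum_rank (enum_val k).1) 0 * v (enum_rank (enum_val k).2) 0).

Definition prod_state (m D : nat) (phi : 'I_m -> 'cV[C]_D) :
    'cV[C]_#|regs m D| :=
  \col_k \prod_(r < m) phi r ((enum_val k : regs m D) r) 0.

(* Splits the m registers into the first two and the remaining m - 2. *)
Definition reg (m : nat) (hm : (1 < m)%N) : 'I_(2 + (m - 2)) -> 'I_m :=
  cast_ord (subnKC hm).

(* u (x) v (x) G: G is an arbitrary, possibly entangled, state of the last
   m - 2 registers. *)
Definition pair_state (m D : nat) (hm : (1 < m)%N) (u v : 'cV[C]_D)
    (G : 'cV[C]_#|regs (m - 2) D|) : 'cV[C]_#|regs m D| :=
  \col_k let s : regs m D := enum_val k in
    u (s (reg hm (lshift (m - 2) 0))) 0 * v (s (reg hm (lshift (m - 2) 1))) 0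
    * G (enum_rank [ffun l : 'I_(m - 2) => s (reg hm (rshift 2 l))]) 0.

End States.

Section Circuits.
Variable R : realType.
Local Notation C := (R[i]).

(* The ancillas undergo arbitrary one-qubit gates and CNOTs (an exactly
   universal gate set); only CSWAPs touch the state registers. *)
Inductive gate (d m : nat) : Type :=
| OneQubit (q : 'I_d) (V : 'M[C]_2) of V \is unitarymx
| CNot (c t : 'I_d) of c != t
| CSwap (c : 'I_d) (r1 r2 : 'I_m).

Definition cnot_conf (d m D : nat) (c t : 'I_d) (x : conf d m D) :
    conf d m D :=
  ([ffun q => if q == t then x.1 c + x.1 t else x.1 q], x.2).

Definition cswap_conf (d m D : nat) (c : 'I_d) (r1 r2 : 'I_m)
    (x : conf d m D) : conf d m D :=
  (x.1, if x.1 c == 1 then [ffun r => x.2 (tperm r1 r2 r)] else x.2).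

Definition opmx (T : finType) (K : T -> T -> C) : 'M[C]_#|T| :=
  \matrix_(k, l) K (enum_val k) (enum_val l).

Definition gate_mx (d m D : nat) (g : gate d m) : 'M[C]_#|conf d m D| :=
  match g with
  | OneQubit q V _ =>
      opmx (fun x y : conf d m D =>
        if (x.2 == y.2) && [forall p, (p != q) ==> (x.1 p == y.1 p)]
        then V (x.1 q) (y.1 q) else 0)
  | CNot c t _ => opmx (fun x y : conf d m D => (x == cnot_conf c t y)%:R)
  | CSwap c r1 r2 =>
      opmx (fun x y : conf d m D => (x == cswap_conf c r1 r2 y)%:R)
  end.

(* The head of the list is applied first. *)
Definition circuit_mx (d m D : nat) (gs : seq (gate d m)) :
    'M[C]_#|conf d m D| :=
  foldl (fun U g => gate_mx D g *m U) 1%:M gs.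

Definition is_cswap (d m : nat) (g : gate d m) : bool :=
  if g is CSwap _ _ _ then true else false.

Definition num_cswap (d m : nat) (gs : seq (gate d m)) : nat :=
  count (@is_cswap d m) gs.

End Circuits.

(* Main.v *)
(* Write n = m(m-1)/2. The ancillas carry one flag qubit and O(ln m) qubits
   holding the label of a pair i < j.  Gates on the ancillas alone are free, and
   they realize enough operators exactly: diagonal phases on one basis state (by
   induction on the number of controls), then, conjugating by a one-qubit
   reflection, two-level reflections on neighbouring basis states, hence all
   transpositions, all permutations and all two-level reflections.  These prepare
   the uniform superposition of the n labels.  For each k, raising the flag when
   i = k, applying one CSWAP of registers 0 and k, and lowering the flag brings
   phi_i to register 0; another such round for j and register 1 brings phi_j there,
   and i < j guarantees that the first round does not displace phi_j.
   This uses 2m CSWAPs. *)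
Require Import Defs.
From HB Require Import structures.
From mathcomp Require Import all_boot all_order all_algebra.
From mathcomp Require Import perm spectral complex.
From mathcomp Require Import all_classical all_reals all_analysis.
From mathcomp Require Import ring zify.
Import Order.TTheory GRing.Theory Num.Theory.
Import numFieldNormedType.Exports.

Set Implicit Arguments.
Unset Strict Implicit.
Unset Printing Implicit Defensive.

Local Open Scope classical_set_scope.
Local Open Scope ring_scope.

(** * Column vectors as wave functions on a finite basis *)

Section Vectors.
Variable R : realType.
Local Notation C := (R[i]).

(** Keeps [enum_rank] out of the computations: a matrix becomes an operator on functions of
    configurations. *)
Definition vec (T : finType) (f : T -> C) : 'cV[C]_#|T| :=
  \col_k f (enum_val k).

Lemma eq_vec (T : finType) (f g : T -> C) : f =1 g -> vec f = vec g.
Proof. by move=> fg; apply/colP => k; rewrite !mxE. Qed.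

Lemma opmx_vec (T : finType) (K : T -> T -> C) (f : T -> C) :
  opmx K *m vec f = vec (fun x => \sum_y K x y * f y).
Proof.
apply/colP => k; rewrite !mxE (reindex enum_rank) /=.
  by apply: eq_bigr => y _; rewrite !mxE enum_rankK.
by apply: onW_bij; exact: enum_rank_bij.
Qed.

Lemma vecE (T : finType) (v : 'cV[C]_#|T|) :
  v = vec (fun x => v (enum_rank x) 0).
Proof. by apply/colP => k; rewrite !mxE enum_valK. Qed.

(** Reduces unitarity of a matrix to its action on vectors, where composing gates is easy. *)
Lemma mulmx_id_eq1 n (A : 'M[C]_n) :
  (forall v : 'cV_n, A *m v = v) -> A = 1%:M.
Proof.
move=> Av; apply/matrixP => i j.
have := congr1 (fun v : 'cV_n => v i 0) (Av (delta_mx j 0)).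
rewrite -colE !mxE => ->; rewrite andbT; by [].
Qed.

End Vectors.

(** * Gates acting on wave functions, and their unitarity *)

Section Gates.
Variables (R : realType) (d m : nat).
Local Notation C := (R[i]).

Definition upd (a : anc d) (q : 'I_d) (b : 'I_2) : anc d :=
  [ffun p => if p == q then b else a p].

Lemma updE (a : anc d) q b p : upd a q b p = if p == q then b else a p.
Proof. by rewrite ffunE. Qed.

Lemma upd_id (a : anc d) q : upd a q (a q) = a.
Proof. by apply/ffunP => p; rewrite updE; case: eqP => [->|]. Qed.

Lemma upd_upd (a : anc d) q b b' : upd (upd a q b) q b' = upd a q b'.
Proof. by apply/ffunP => p; rewrite !updE; case: eqP. Qed.

Definition cnot (c t : 'I_d) (a : anc d) : anc d := upd a t (a c + a t).

Lemma I2_addrr (x : 'I_2) : x + x = 0.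
Proof. by apply/val_inj; case: x => [[|[|x]]] //. Qed.

Lemma cnotK c t : c != t -> involutive (cnot c t).
Proof.
move=> ct a; rewrite /cnot upd_upd !updE eqxx (negbTE ct).
by rewrite addrA I2_addrr add0r upd_id.
Qed.

Definition swap_regs D (r1 r2 : 'I_m) (s : regs m D) : regs m D :=
  [ffun r => s (tperm r1 r2 r)].

Lemma swap_regsK D r1 r2 : involutive (@swap_regs D r1 r2).
Proof. by move=> s; apply/ffunP => r; rewrite !ffunE tpermK. Qed.

Definition one_qubit (q : 'I_d) (V : 'M[C]_2) (f : anc d -> C) (a : anc d) : C :=
  \sum_b V (a q) b * f (upd a q b).

Definition one_qubit_mx D q V : 'M[C]_#|conf d m D| :=
  opmx (fun x y : conf d m D =>
        if (x.2 == y.2) && [forall p, (p != q) ==> (x.1 p == y.1 p)]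
        then V (x.1 q) (y.1 q) else 0).

Lemma one_qubit_mx_vec D q (V : 'M[C]_2) (f : conf d m D -> C) :
  one_qubit_mx D q V *m vec f =
  vec (fun x : conf d m D => one_qubit q V (fun a => f (a, x.2)) x.1).
Proof.
rewrite opmx_vec; apply: eq_vec => -[a s] /=; rewrite /one_qubit.
(* The row of [(a, s)] is supported on the two configurations [h b]. *)
pose h (b : 'I_2) : conf d m D := (upd a q b, s).
rewrite (bigID (mem (codom h))) /= [X in _ + X]big1 ?addr0; last first.
  move=> [a' s'] /= nh; case: ifP => [/andP[/eqP ss /forallP aa]|]; last by rewrite mul0r.
  case/negP: nh; apply/codomP; exists (a' q); rewrite /h -ss; congr pair.
  apply/ffunP => p; rewrite updE; case: eqP => [->//|/eqP pq].
  by have := aa p; rewrite pq => /eqP.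
rewrite (reindex_onto h (fun x : conf d m D => x.1 q)) /=; last first.
  by move=> x /codomP[b ->]; rewrite /= updE eqxx.
apply: eq_big => [b|b _]; first by rewrite codom_f updE eqxx eqxx.
rewrite eqxx updE eqxx /=; case: ifP => // /negP[].
by apply/forallP => p; apply/implyP => /negbTE pq; rewrite updE pq.
Qed.

(** A permutation matrix pulls wave functions back along the inverse permutation, which for an
    involution is [g] itself. *)
Lemma sum_eq_inv (T : finType) (g : T -> T) (f : T -> C) x :
  involutive g -> \sum_y (x == g y)%:R * f y = f (g x).
Proof.
move=> gK; rewrite (bigD1 (g x)) //= gK eqxx mul1r big1 ?addr0 // => y ny.
case: eqP => [xy|_]; last by rewrite mul0r.
by rewrite xy gK eqxx in ny.
Qed.

Lemma cnot_confK D c t : c != t -> involutive (@cnot_conf d m D c t).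
Proof. by move=> ct [a s]; congr pair; exact: (cnotK ct a). Qed.

Lemma cswap_confK D c r1 r2 : involutive (@cswap_conf d m D c r1 r2).
Proof.
move=> [a s]; rewrite /cswap_conf /=; congr pair.
by case: (a c == 1) => //; exact: swap_regsK.
Qed.

Lemma CNot_vec D c t (ct : c != t) (f : conf d m D -> C) :
  gate_mx D (CNot R m ct) *m vec f = vec (fun x : conf d m D => f (cnot c t x.1, x.2)).
Proof.
by rewrite opmx_vec; apply: eq_vec => x; rewrite sum_eq_inv //; exact: cnot_confK.
Qed.

Lemma CSwap_vec D c r1 r2 (f : conf d m D -> C) :
  gate_mx D (CSwap R c r1 r2) *m vec f =
  vec (fun x : conf d m D => f (x.1, if x.1 c == 1 then swap_regs r1 r2 x.2 else x.2)).
Proof.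
by rewrite opmx_vec; apply: eq_vec => x; rewrite sum_eq_inv //; exact: cswap_confK.
Qed.

(** The permutation matrix of an involution is real and symmetric, so it is its own adjoint and its
    own inverse. *)
Lemma opmx_inv_unitary (T : finType) (g : T -> T) : involutive g ->
  opmx (fun x y => (x == g y)%:R : C) \is unitarymx.
Proof.
move=> gK; apply/unitarymxP.
have -> : (opmx (fun x y => (x == g y)%:R : C))^t*%sesqui =
    opmx (fun x y => (x == g y)%:R : C).
  apply/matrixP => i j; rewrite !mxE conjC_nat; congr (_ %:R).
  by congr nat_of_bool; apply/eqP/eqP => ->; rewrite gK.
apply: mulmx_id_eq1 => v; rewrite (vecE v) -mulmxA !opmx_vec.
by apply: eq_vec => x; rewrite !sum_eq_inv // gK.
Qed.

Lemma one_qubitM q (V W : 'M[C]_2) f a :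
  one_qubit q V (one_qubit q W f) a = one_qubit q (V *m W) f a.
Proof.
rewrite /one_qubit.
under eq_bigr => b _ do rewrite updE eqxx mulr_sumr.
rewrite exchange_big; apply: eq_bigr => b _ /=.
rewrite mxE mulr_suml; apply: eq_bigr => b' _.
by rewrite upd_upd mulrA.
Qed.

Lemma one_qubit1 q f a : one_qubit q 1%:M f a = f a.
Proof.
rewrite /one_qubit (bigD1 (a q)) //= mxE eqxx mul1r upd_id big1 ?addr0 // => b.
by rewrite mxE eq_sym => /negbTE ->; rewrite mul0r.
Qed.

Lemma one_qubit_unitary D q (V : 'M[C]_2) :
  V \is unitarymx -> one_qubit_mx D q V \is unitarymx.
Proof.
move=> /unitarymxP VV; apply/unitarymxP.
have -> : (one_qubit_mx D q V)^t*%sesqui = one_qubit_mx D q (V^t*%sesqui).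
  apply/matrixP => i j; rewrite !mxE eq_sym.
  have -> : [forall p, (p != q) ==> ((enum_val i).1 p == (enum_val j).1 p)] =
    [forall p, (p != q) ==> ((enum_val j).1 p == (enum_val i).1 p)].
    by apply: eq_forallb => p; rewrite (eq_sym ((enum_val i).1 p)).
  by case: ifP => _; rewrite ?conjC0.
apply: mulmx_id_eq1 => v; rewrite (vecE v) -mulmxA !one_qubit_mx_vec.
apply: eq_vec => -[a s].
apply: etrans (one_qubitM q V _ (fun a => v (enum_rank (a, s)) 0) a) _.
by rewrite VV one_qubit1.
Qed.

Lemma gate_unitary D (g : gate R d m) : gate_mx D g \is unitarymx.
Proof.
case: g => [q V VU|c t ct|c r1 r2].
- exact: one_qubit_unitary.
- by apply: opmx_inv_unitary; exact: cnot_confK.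
- by apply: opmx_inv_unitary; exact: cswap_confK.
Qed.

Lemma circuit_mx_cat D (gs hs : seq (gate R d m)) :
  circuit_mx D (gs ++ hs) = circuit_mx D hs *m circuit_mx D gs.
Proof.
rewrite /circuit_mx foldl_cat; move: (foldl _ 1%:M gs) => U.
elim/last_ind: hs => [|hs g IH] /=; first by rewrite mul1mx.
by rewrite !foldl_rcons IH mulmxA.
Qed.

Lemma circuit_unitary D (gs : seq (gate R d m)) : circuit_mx D gs \is unitarymx.
Proof.
elim: gs => [|g gs IH].
  by apply/unitarymxP; rewrite /circuit_mx /= mul1mx trmx1 map_mx1.
rewrite -cat1s circuit_mx_cat mul_unitarymx // /circuit_mx /= mulmx1.
exact: gate_unitary.
Qed.

End Gates.

(** * Ancilla operators realized without CSWAPs; multi-controlled phases *)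

Section Realizable.
Variables (R : realType) (d m : nat).
Local Notation C := (R[i]).
Implicit Types (f : anc d -> C) (a : anc d).

(* Operators on the ancillas are maps of wave functions [anc d -> C]; the
   register configuration is a spectator. *)
Definition realizable (F : (anc d -> C) -> anc d -> C) : Prop :=
  exists2 gs : seq (gate R d m), num_cswap gs = 0%N &
    forall D (f : conf d m D -> C),
      circuit_mx D gs *m vec f =
      vec (fun x : conf d m D => F (fun a => f (a, x.2)) x.1).

Lemma realizable_ext F G : (forall f a, F f a = G f a) ->
  realizable F -> realizable G.
Proof.
move=> FG [gs gs0 gsF]; exists gs => // D f; rewrite gsF.
by apply: eq_vec => x; rewrite FG.
Qed.

Lemma realizable_id : realizable (fun f => f).
Proof.
exists [::] => // D f; rewrite /circuit_mx /= mul1mx.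
by apply: eq_vec => -[].
Qed.

Lemma realizable_comp F G : realizable F -> realizable G ->
  realizable (fun f => G (F f)).
Proof.
move=> [gs gs0 gsF] [hs hs0 hsG]; exists (gs ++ hs).
  by rewrite /num_cswap count_cat -/(num_cswap gs) -/(num_cswap hs) gs0 hs0.
by move=> D f; rewrite circuit_mx_cat -mulmxA gsF hsG.
Qed.

Lemma circuit_mx1 D (g : gate R d m) : circuit_mx D [:: g] = gate_mx D g.
Proof. by rewrite /circuit_mx /= mulmx1. Qed.

Lemma realizable_one_qubit q (V : 'M[C]_2) : V \is unitarymx ->
  realizable (one_qubit q V).
Proof.
move=> VU; exists [:: OneQubit m q VU] => // D f.
by rewrite circuit_mx1 -one_qubit_mx_vec.
Qed.

Lemma realizable_cnot c t : c != t -> realizable (fun f a => f (cnot c t a)).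
Proof. by move=> ct; exists [:: CNot R m ct] => // D f; rewrite circuit_mx1 CNot_vec. Qed.

Definition matches (s : anc d) (r : seq 'I_d) (a : anc d) : bool :=
  all (fun q => a q == s q) r.

Lemma matches_upd s r a q b : q \notin r -> matches s r (upd a q b) = matches s r a.
Proof.
move=> qr; apply: eq_in_all => p pr; rewrite updE; case: (p =P q) => // pq.
by rewrite -pq pr in qr.
Qed.

Lemma upd_matches s r a q b : q \notin r -> matches (upd s q b) r a = matches s r a.
Proof.
move=> qr; apply: eq_in_all => p pr; rewrite updE; case: (p =P q) => // pq.
by rewrite -pq pr in qr.
Qed.

Lemma diag2_unitary (u v : C) : `|u| = 1 -> `|v| = 1 ->
  \matrix_(i, j < 2) (if i == j then if i == 1 then u else v else 0) \is unitarymx.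
Proof.
move=> u1 v1; apply/unitarymxP/matrixP => i j; rewrite !mxE.
have nn (w : C) : `|w| = 1 -> w * w^* = 1 by move=> w1; rewrite -normCK w1 expr1n.
case: i => [[|[|]]] // hi; case: j => [[|[|]]] // hj;
  rewrite big_ord_recl big_ord1 !mxE /= ?conjC0 ?mul0r ?mulr0 ?addr0 ?add0r ?nn //.
Qed.

Lemma I2_neq (x y z : 'I_2) : x != y -> z != y -> x = z.
Proof.
by case: x y z => [[|[|]]] // ? [[|[|]]] // ? [[|[|]]] // ? *; apply/val_inj.
Qed.

(** Lets the target of a CNOT detect that exactly one of two bits agrees with its prescribed
    value. *)
Lemma I2_xor (x y s t : 'I_2) :
  (x + y == s + t + 1) = (x == s) (+) (y == t).
Proof.
by case: x y s t => [[|[|]]] // ? [[|[|]]] // ? [[|[|]]] // ? [[|[|]]].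
Qed.

(* Induction on the number of controls, from the identity
   2 x y = x + y - (x (+) y) on bits: the phase of the product of the two bits
   is split over x, y and their sum, which a CNOT makes available on a qubit. *)
Lemma realizable_phase s q r (z : C) : uniq (q :: r) -> `|z| = 1 ->
  realizable (fun f a => (if matches s (q :: r) a then z else 1) * f a).
Proof.
elim: r => [|t r IH] in q s z *.
  move=> _ z1.
  have u1 : `|if s q == 1 then z else 1| = 1 by case: ifP => _; rewrite ?normr1.
  have v1 : `|if s q == 1 then 1 else z| = 1 by case: ifP => _; rewrite ?normr1.
  apply: realizable_ext (realizable_one_qubit q (diag2_unitary u1 v1)) => f a.
  rewrite /one_qubit (bigD1 (a q)) //= big1 => [|b ba]; last first.
    by rewrite mxE eq_sym (negbTE ba) mul0r.
  rewrite mxE eqxx addr0 upd_id /matches /= andbT; congr (_ * _).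
  case: (s q) (a q) => [[|[|]]] // ? [[|[|]]] // ?.
move=> /= /andP[]; rewrite inE negb_or => /andP[qt qr] /andP[tr ur] z1.
(* A factor [w] for each of the two agreements and [w^-1] for exactly one agreement multiply to
   [w * w = z] if both bits agree and to 1 otherwise. *)
pose w := sqrtC z.
have ww : w * w = z by rewrite -expr2 sqrtCK.
have w1 : `|w| = 1.
  by apply/eqP; rewrite -(@eqrXn2 _ 2) // -normrX sqrtCK z1 expr1n.
have w0 : w != 0 by rewrite -normr_eq0 w1 oner_eq0.
have uq : uniq (q :: r) by rewrite /= qr.
have ut : uniq (t :: r) by rewrite /= tr.
have v1 : `|w^-1| = 1 by rewrite normfV w1 invr1.
have A := realizable_comp (IH q s w uq w1) (IH t s w ut w1).
(* The first CNOT writes the sum of the two bits into [t], the second restores [t]. *)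
have B := realizable_comp (realizable_cnot qt)
  (realizable_comp (IH t (upd s t (s q + s t + 1)) w^-1 ut v1) (realizable_cnot qt)).
apply: realizable_ext (realizable_comp A B) => f a /=.
rewrite cnotK // [X in if X then w^-1 else 1]/= updE eqxx -/(matches _ _ _).
rewrite upd_matches // matches_upd // updE eqxx I2_xor -/(matches s r a).
case: (matches s r a); case: (a q == s q); case: (a t == s t) => /=;
  rewrite ?mul1r ?mulrA ?ww ?mulVf ?mulfV ?mul1r //.
Qed.

End Realizable.

(** * Two-level reflections on neighbouring bit strings *)

Section TwoLevel.
Variables (R : realType) (d m : nat).
Local Notation C := (R[i]).
Implicit Types (f : anc d -> C) (a x y : anc d).
Local Notation realizable := (@realizable R d m).

(** On the span of [x] and [y] this is the reflection with rows [(u, v)] and [(v, - u)]. *)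
Definition two_level x y (u v : C) f a : C :=
  if a == x then u * f x + v * f y
  else if a == y then v * f x - u * f y else f a.

Lemma matches_enum x a : matches x (enum 'I_d) a = (a == x).
Proof.
apply/allP/eqP => [ax|-> //].
by apply/ffunP => q; apply/eqP/ax; rewrite mem_enum.
Qed.

Lemma realizable_point_phase (t : 'I_d) y (z : C) : `|z| = 1 ->
  realizable (fun f a => (if a == y then z else 1) * f a).
Proof.
move=> z1; case E : (enum 'I_d) => [|q r].
  (* The qubit [t] excludes an empty list of controls. *)
  by have := mem_enum 'I_d t; rewrite E.
have qr : uniq (q :: r) by rewrite -E enum_uniq.
apply: realizable_ext (realizable_phase m y qr z1).
by move=> f a; rewrite -E matches_enum.
Qed.

Definition refl_mx (c s : C) : 'M[C]_2 :=
  \matrix_(i, j) (if i == j then if i == 0 then c else - c else s).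

Lemma one_qubit_refl t c s f a : one_qubit t (refl_mx c s) f a =
  if a t == 0 then c * f (upd a t 0) + s * f (upd a t 1)
  else s * f (upd a t 0) - c * f (upd a t 1).
Proof.
rewrite /one_qubit big_ord_recl big_ord1 !mxE.
have -> : lift ord0 (ord0 : 'I_1) = 1 :> 'I_2 by apply/val_inj.
have -> : ord0 = 0 :> 'I_2 by [].
by case: (a t) => [[|[|]]] // ?; rewrite /= ?mulNr.
Qed.

Lemma refl_unitary c s : 0 <= c -> 0 <= s -> c ^+ 2 + s ^+ 2 = 1 ->
  refl_mx c s \is unitarymx.
Proof.
move=> c0 s0 cs; apply/unitarymxP/matrixP => i j; rewrite !mxE.
have cc : c^* = c by apply/CrealP/ger0_real.
have ss : s^* = s by apply/CrealP/ger0_real.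
rewrite big_ord_recl big_ord1 !mxE.
case: i => [[|[|]]] // hi; case: j => [[|[|]]] // hj;
  rewrite /= ?rmorphN /= ?cc ?ss -?cs; ring.
Qed.

(** A sign flip at the second string is conjugated by a one-qubit reflection Q on [t]: Q diag(1, -1)
    Q doubles the angle on the pair, and Q Q = 1 elsewhere. *)
Lemma realizable_neighbour x t (u v : C) : x t = 0 ->
  0 <= u -> 0 <= v -> u ^+ 2 + v ^+ 2 = 1 ->
  realizable (two_level x (upd x t 1) u v).
Proof.
move=> xt u0 v0 uv; set y := upd x t 1.
have u1 : u <= 1.
  by rewrite -(@ler_pXn2r _ 2) // ?nnegrE // expr1n -uv lerDl exprn_ge0.
(* Half-angle formulas: [u] is the cosine and [v] the sine of twice the angle of [(c, s)]. *)
pose c := sqrtC ((1 + u) / 2); pose s := sqrtC ((1 - u) / 2).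
have cE : c ^+ 2 = (1 + u) / 2 by rewrite sqrtCK.
have sE : s ^+ 2 = (1 - u) / 2 by rewrite sqrtCK.
have c0 : 0 <= c by rewrite sqrtC_ge0 divr_ge0 // addr_ge0.
have s0 : 0 <= s by rewrite sqrtC_ge0 divr_ge0 // subr_ge0.
have csE : c ^+ 2 + s ^+ 2 = 1 by rewrite cE sE; field.
have uE : u = c ^+ 2 - s ^+ 2 by rewrite cE sE; field.
have vE : v = 2 * (c * s).
  apply/eqP; rewrite -(@eqrXn2 _ 2) // ?mulr_ge0 //; apply/eqP.
  have -> : v ^+ 2 = 1 - u ^+ 2 by rewrite -uv addrC addKr.
  by rewrite !exprMn cE sE; field.
have Q := realizable_one_qubit m t (refl_unitary c0 s0 csE).
have N1 : `|-1 : C| = 1 by rewrite normrN1.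
have P := realizable_point_phase t y N1.
apply: realizable_ext (realizable_comp (realizable_comp Q P) Q) => f a /=.
rewrite one_qubit_refl !one_qubit_refl !upd_upd !updE !eqxx /=.
have y0 : upd a t 0 == y = false.
  by apply/eqP => /ffunP/(_ t); rewrite !updE eqxx.
have xy : x != y by apply/eqP => /ffunP/(_ t); rewrite !updE eqxx xt.
rewrite y0 mul1r /two_level.
have [ay|ay] := eqVneq (upd a t 1) y.
  have ax : upd a t 0 = x.
    apply/ffunP => q; move/ffunP: ay => /(_ q); rewrite !updE.
    by case: (q =P t) => [->|].
  rewrite ax ay; case: ifP => at0.
    have -> : a = x by rewrite -ax -(eqP at0) upd_id.
    by rewrite eqxx uE vE; ring.
  have -> : a = y.
    rewrite -ay; apply/ffunP => q; rewrite updE; case: (q =P t) => // ->.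
    by apply: I2_neq (negbT at0) _.
  by rewrite eq_sym (negbTE xy) eqxx uE vE; ring.
have ax : a == x = false.
  by apply: contra_neqF ay => /eqP ->.
have ay' : a == y = false.
  by apply: contra_neqF ay => /eqP ->; rewrite /y upd_upd.
rewrite ax ay'; have f0 : f a = (c ^+ 2 + s ^+ 2) * f a by rewrite csE mul1r.
case: ifP => at0.
  have -> : upd a t 0 = a by rewrite -(eqP at0) upd_id.
  by rewrite [RHS]f0; ring.
have a1 : a t = 1 by apply: I2_neq (negbT at0) _.
have -> : upd a t 1 = a by rewrite -a1 upd_id.
by rewrite [RHS]f0; ring.
Qed.

End TwoLevel.

(** * Permutations, arbitrary two-level reflections, uniform superpositions *)

Section Permutations.
Variables (R : realType) (d m : nat).
Local Notation C := (R[i]).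
Implicit Types (f : anc d -> C) (a x y : anc d).
Local Notation realizable := (@realizable R d m).

Definition perm_realizable (s : {perm anc d}) : Prop :=
  realizable (fun f a => f (s a)).

Lemma perm_realizable1 : perm_realizable 1%g.
Proof. by apply: realizable_ext (realizable_id R d m) => f a; rewrite perm1. Qed.

Lemma perm_realizableM s t : perm_realizable s -> perm_realizable t ->
  perm_realizable (s * t)%g.
Proof.
by move=> S T; apply: realizable_ext (realizable_comp T S) => f a; rewrite permM.
Qed.

(** A two-level reflection with [u = 0] and [v = 1] is a transposition. The neighbour construction
    starts from bit 0 at [t]; when [x t] is 1, the two strings exchange roles. *)
Lemma tperm_upd_realizable x t b : perm_realizable (tperm x (upd x t b)).
Proof.
have [->|nb] := eqVneq b (x t).
  by rewrite upd_id tperm1; exact: perm_realizable1.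
have base (z : anc d) : z t = 0 -> perm_realizable (tperm z (upd z t 1)).
  move=> zt; have := @realizable_neighbour R d m z t 0 1 zt (lexx 0) ler01.
  rewrite expr0n expr1n add0r => /(_ erefl); apply: realizable_ext => f a.
  rewrite /two_level !mul0r !mul1r add0r subr0.
  case: tpermP => [->|->|/eqP/negbTE -> /eqP/negbTE -> //]; rewrite ?eqxx //.
  by case: eqP => // ->.
have [xt|xt] := eqVneq (x t) 0.
  have -> : b = 1 by apply: I2_neq nb _; rewrite xt.
  exact: base.
have b0 : b = 0 by apply: I2_neq nb _; rewrite eq_sym.
set w := upd x t b; have -> : x = upd w t 1.
  by rewrite upd_upd -{1}(upd_id x t); congr upd; exact: I2_neq xt _.
rewrite tpermC; apply: base.
by rewrite updE eqxx.
Qed.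

(** Walk from [x] to [y] one bit at a time, each step conjugating the remaining transposition by a
    one-bit one. *)
Lemma tperm_realizable x y : perm_realizable (tperm x y).
Proof.
(* [r] contains the qubits where [z] may still differ from [y]. *)
suff H (r : seq 'I_d) : forall z : anc d, (forall q, q \notin r -> z q = y q) ->
    perm_realizable (tperm z y).
  by apply: (H (enum 'I_d)) => q; rewrite mem_enum.
elim: r => [|t r IH] z zy.
  have -> : z = y by apply/ffunP => q; exact: zy.
  by rewrite tperm1; exact: perm_realizable1.
have Hw := tperm_upd_realizable z t (y t); set w := upd z t (y t) in Hw.
have {}IH : perm_realizable (tperm w y).
  apply: IH => q qr; rewrite updE; case: (q =P t) => [->//|/eqP qt].
  by apply: zy; rewrite inE negb_or qt.
have [->|zw] := eqVneq z w; first exact: IH.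
have [<-|zy'] := eqVneq z y; first by rewrite tperm1; exact: perm_realizable1.
have [wy|wy] := eqVneq w y; first by rewrite -wy.
have -> : tperm z y = (tperm z w * tperm w y * tperm z w)%g.
  have := conjgE (tperm w y) (tperm z w); rewrite tpermV mulgA => <-.
  by rewrite tpermJ tpermR tpermD // eq_sym.
by do 2?apply: perm_realizableM.
Qed.

Lemma all_perm_realizable (s : {perm anc d}) : perm_realizable s.
Proof.
have [ts -> _] := prod_tpermP s; apply: big_ind => [||t _].
- exact: perm_realizable1.
- exact: perm_realizableM.
- exact: tperm_realizable.
Qed.

(** Conjugation by a permutation that carries [x] and [y] to two strings differing only at [t]. *)
Lemma realizable_two_level (t : 'I_d) x y (u v : C) : x != y ->
  0 <= u -> 0 <= v -> u ^+ 2 + v ^+ 2 = 1 -> realizable (two_level x y u v).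
Proof.
move=> xy u0 v0 uv.
pose s0 : anc d := [ffun=> 0]; pose s1 := upd s0 t 1.
have s01 : s0 != s1 by apply/eqP => /ffunP/(_ t); rewrite /s1 updE eqxx ffunE.
(* The first factor sends [x] to [s0]; the second moves the image of [y] to [s1] and fixes [s0]. *)
pose g := (tperm x s0 * tperm (tperm x s0 y) s1)%g.
have gy : g y = s1 by rewrite permM tpermL.
have gx : g x = s0.
  rewrite permM tpermL tpermD // 1?eq_sym //.
  by rewrite -[X in X != _](tpermL x s0) (inj_eq perm_inj).
have H := @realizable_neighbour R d m s0 t u v (ffunE _ _) u0 v0 uv.
have := realizable_comp (all_perm_realizable g^-1)
   (realizable_comp H (all_perm_realizable g)).
apply: realizable_ext => f a /=; rewrite /two_level -/s1 -gx -gy !permK.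
by rewrite !(inj_eq perm_inj).
Qed.

(* [x] starts with all the amplitude, and two-level reflections hand its share
   to each element of [l] in turn. *)
Lemma realizable_uniform (t : 'I_d) (l : seq (anc d)) x : uniq (x :: l) ->
  exists2 F, realizable F &
    forall f (c : C), f x = sqrtC (size l).+1%:R * c ->
      {in l, forall y, f y = 0} ->
      forall a, F f a = if a \in x :: l then c else f a.
Proof.
elim: l => [_|y l IH].
  exists id; first exact: realizable_id.
  move=> f c; rewrite sqrtC1 mul1r => fx _ a; rewrite inE.
  by case: eqP => [->|].
rewrite [uniq _]/= inE negb_or => /andP[/andP[xy xl] /andP[yl ul]].
have [|F FR FE] := IH; first by rewrite /= xl.
pose k : C := (size l).+1%:R; pose k1 : C := (size l).+2%:R.
have k0 : 0 < k by rewrite ltr0n.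
have k10 : 0 < k1 by rewrite ltr0n.
have kk : k1 = k + 1 by rewrite /k1 -natr1.
(* The amplitude [sqrtC k1 * c] at [x] splits into [c], handed to [y], and [sqrtC k * c], kept at
   [x] for the induction hypothesis. *)
pose u := sqrtC (k / k1); pose v := sqrtC (k1^-1).
have u0 : 0 <= u by rewrite sqrtC_ge0 divr_ge0 // ltW.
have v0 : 0 <= v by rewrite sqrtC_ge0 invr_ge0 ltW.
have uv : u ^+ 2 + v ^+ 2 = 1.
  by rewrite !sqrtCK -[X in _ + X]mul1r -mulrDl -kk divff // gt_eqF.
have sk : sqrtC k1 != 0 by rewrite sqrtC_eq0 gt_eqF.
have uk : u * sqrtC k1 = sqrtC k.
  by rewrite -rootCMl ?divr_ge0 1?ltW // divfK // gt_eqF.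
have vk : v * sqrtC k1 = 1.
  by rewrite -rootCMl ?invr_ge0 1?ltW // mulVf ?sqrtC1 // gt_eqF.
exists (fun f => F (two_level x y u v f)).
  by apply: realizable_comp FR; exact: realizable_two_level.
move=> f c fx f0 a.
have fy : f y = 0 by apply: f0; rewrite mem_head.
have yx : (y == x) = false by rewrite eq_sym (negbTE xy).
rewrite (FE _ c).
- rewrite !inE /two_level eq_sym; case: (x =P a) => //= _.
  case: (a =P y) => [->|_].
    by rewrite (negbTE yl) fx fy mulr0 subr0 mulrA vk mul1r.
  by [].
- by rewrite /two_level eqxx fx fy mulr0 addr0 mulrA uk.
- move=> z zl; rewrite /two_level.
  case: eqP => [zx|_]; first by rewrite -zx zl in xl.
  case: eqP => [zy|_]; first by rewrite -zy zl in yl.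
  by apply: f0; rewrite inE zl orbT.
Qed.

End Permutations.

(** * Swaps controlled by a predicate of the ancillas *)

Section ControlledSwaps.
Variables (R : realType) (d m : nat) (t : 'I_d).
Local Notation C := (R[i]).
Implicit Types (A : pred (anc d)) (a : anc d).

(* Flips the flag qubit [t] exactly when the other qubits satisfy [A]; being an
   involution, it uncomputes itself. *)
Definition flag A a : anc d := if A (upd a t 0) then upd a t (a t + 1) else a.

Lemma flagK A : involutive (flag A).
Proof.
move=> a; rewrite /flag; case H: (A (upd a t 0)); last by rewrite H.
by rewrite !upd_upd H updE eqxx -addrA I2_addrr addr0 upd_id.
Qed.

Definition controlled_swap D A r1 r2 a (s : regs m D) : regs m D :=
  if flag A a t == 1 then swap_regs r1 r2 s else s.

Lemma controlled_swapE D A r1 r2 a (s : regs m D) : a t = 0 ->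
  controlled_swap A r1 r2 a s = if A a then swap_regs r1 r2 s else s.
Proof.
move=> a0; have aE : upd a t 0 = a by rewrite -a0 upd_id.
by rewrite /controlled_swap /flag aE; case: (A a); rewrite ?updE ?eqxx a0.
Qed.

(** Flip the flag, apply one CSWAP controlled by it, flip it back; the flips are ancilla
    permutations, hence free of CSWAPs. *)
Lemma controlled_swap_circuit A r1 r2 :
  exists2 gs : seq (gate R d m), num_cswap gs = 1%N &
    forall D (f : conf d m D -> C), circuit_mx D gs *m vec f =
      vec (fun x : conf d m D => f (x.1, controlled_swap A r1 r2 x.1 x.2)).
Proof.
have [gs gs0 gsE] := all_perm_realizable R m (perm (inv_inj (flagK A))).
exists (gs ++ CSwap R t r1 r2 :: gs).
  by rewrite /num_cswap count_cat /= -/(num_cswap gs) gs0.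
move=> D f; rewrite circuit_mx_cat -cat1s circuit_mx_cat circuit_mx1 -!mulmxA.
rewrite gsE CSwap_vec gsE; apply: eq_vec => -[a s] /=.
by rewrite !permE flagK.
Qed.

(** Gates pull wave functions back, so the first gate is the outermost map on configurations; hence
    [foldr]. *)
Definition controlled_swaps D (sts : seq (pred (anc d) * 'I_m * 'I_m)) a
    (s : regs m D) : regs m D :=
  foldr (fun st => controlled_swap st.1.1 st.1.2 st.2 a) s sts.

Lemma controlled_swaps_circuit sts :
  exists2 gs : seq (gate R d m), num_cswap gs = size sts &
    forall D (f : conf d m D -> C), circuit_mx D gs *m vec f =
      vec (fun x : conf d m D => f (x.1, controlled_swaps sts x.1 x.2)).
Proof.
elim: sts => [|[[A r1] r2] sts [gs gsn gsE]].
  exists [::] => // D f; rewrite /circuit_mx /= mul1mx.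
  by apply: eq_vec => -[].
have [hs hsn hsE] := controlled_swap_circuit A r1 r2.
exists (hs ++ gs).
  by rewrite /num_cswap count_cat -/(num_cswap gs) -/(num_cswap hs) gsn hsn.
by move=> D f; rewrite circuit_mx_cat -mulmxA hsE gsE.
Qed.

End ControlledSwaps.

(** Collapses a loop over register numbers in which only the round of [i] fires. *)
Lemma foldr_only (K : eqType) (U : Type) (b : pred K) (g : K -> U -> U) i ks u :
  uniq ks -> i \in ks -> b =1 pred1 i ->
  foldr (fun k v => if b k then g k v else v) u ks = g i u.
Proof.
move=> uks iks bi.
have off r : i \notin r -> foldr (fun k v => if b k then g k v else v) u r = u.
  elim: r => //= k r IH; rewrite inE negb_or => /andP[ik ir].
  by rewrite bi /= eq_sym (negbTE ik) IH.
elim: ks uks iks => //= k r IH /andP[kr ur]; rewrite inE bi /=.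
have [ik|ik] := eqVneq i k; first by rewrite off -?ik // ik.
exact: IH.
Qed.

(** * Product states and permutations of their registers *)

Section ProductStates.
Variables (R : realType) (D : nat).
Local Notation C := (R[i]).

Definition amplitude m (phi : 'I_m -> 'cV[C]_D) (s : regs m D) : C :=
  \prod_(r < m) phi r (s r) 0.

(** By distributivity the sum over all configurations factors into the squared norms of the
    [phi r]. *)
Lemma prod_state_normalized m (phi : 'I_m -> 'cV[C]_D) :
  (forall r, normalized (phi r)) -> normalized (prod_state phi).
Proof.
move=> phi1; rewrite /normalized (reindex enum_rank) /=; last first.
  by apply: onW_bij; exact: enum_rank_bij.
under eq_bigr => s _ do rewrite mxE enum_rankK normr_prod -prodrXl.
rewrite -(bigA_distr_bigA (fun r j => `|phi r j 0| ^+ 2)) /=.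
by apply: big1 => r _; exact: phi1.
Qed.

Lemma tens_ketE d m (x : anc d) (v : 'cV[C]_#|regs m D|) k :
  tens (ket R x) v k 0 =
  ((enum_val k : conf d m D).1 == x)%:R * v (enum_rank (enum_val k : conf d m D).2) 0.
Proof. by rewrite !mxE eqxx andbT (inj_eq enum_rank_inj). Qed.

Lemma amplitude_swap m (phi : 'I_m -> 'cV[C]_D) r1 r2 s :
  amplitude phi (swap_regs r1 r2 s) = amplitude (fun r => phi (tperm r1 r2 r)) s.
Proof.
rewrite /amplitude (reindex_inj (@perm_inj _ (tperm r1 r2))).
by apply: eq_bigr => r _; rewrite ffunE tpermK.
Qed.

(** Gives any product state the form of a summand of the theorem, with a garbage state that is
    itself a product. *)
Lemma pair_stateE m (hm : (1 < m)%N) (psi : 'I_m -> 'cV[C]_D) k :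
  pair_state hm (psi (reg hm (lshift _ 0))) (psi (reg hm (lshift _ 1)))
    (prod_state (fun l : 'I_(m - 2) => psi (reg hm (rshift 2 l)))) k 0 =
  amplitude psi (enum_val k).
Proof.
have rb : bijective (reg hm).
  exists (cast_ord (esym (subnKC hm))) => i; rewrite /reg ?cast_ordK ?cast_ordKV //.
rewrite /amplitude (reindex (reg hm)); last exact: onW_bij.
rewrite big_split_ord big_ord_recl big_ord1 mxE /= mxE enum_rankK.
have -> : lift ord0 (ord0 : 'I_1) = 1 :> 'I_2 by apply/val_inj.
by congr (_ * _); apply: eq_bigr => l _; rewrite ffunE.
Qed.

End ProductStates.

(** Grouping by the larger entry gives 0 + 1 + ... + (m - 1). *)
Lemma card_ltn_pairs m :
  #|[pred p : 'I_m * 'I_m | (p.1 < p.2)%N]| = (m * (m - 1) %/ 2)%N.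
Proof.
rewrite -sum1_card.
rewrite -(pair_big_dep xpredT (fun j i : 'I_m => (j < i)%N) (fun _ _ => 1%N)) /=.
rewrite (exchange_big_dep xpredT) //=.
under eq_bigr => j _.
  rewrite -(big_ord_widen m (fun=> 1%N) (ltnW (ltn_ord j))) sum1_card card_ord.
  over.
by rewrite -(big_mkord xpredT id) bin2_sum bin2 -divn2 subn1.
Qed.

(** * The circuit for a given injective labelling of the pairs *)

Section PairCircuit.
Variables (R : realType) (d m : nat) (t : 'I_d) (hm : (1 < m)%N).
Variable label : 'I_m * 'I_m -> anc d.
Hypothesis label_inj : injective label.
Hypothesis label_flag : forall p, label p t = 0.
Local Notation C := (R[i]).

Definition r0 : 'I_m := reg hm (lshift (m - 2) 0).
Definition r1 : 'I_m := reg hm (lshift (m - 2) 1).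
Definition pairs : seq ('I_m * 'I_m) := enum [pred p : 'I_m * 'I_m | (p.1 < p.2)%N].

(** After the swaps for [p], register [r] holds [phi (bring p r)]. *)
Definition bring (p : 'I_m * 'I_m) (r : 'I_m) : 'I_m := tperm r0 p.1 (tperm r1 p.2 r).

Definition is_fst (k : 'I_m) : pred (anc d) :=
  [pred a | [exists p, (label p == a) && (p.1 == k)]].
Definition is_snd (k : 'I_m) : pred (anc d) :=
  [pred a | [exists p, (label p == a) && (p.2 == k)]].

Lemma is_fst_label k p : is_fst k (label p) = (k == p.1).
Proof.
apply/existsP/eqP => [[q /andP[/eqP/label_inj -> /eqP //]]|->].
by exists p; rewrite !eqxx.
Qed.

Lemma is_snd_label k p : is_snd k (label p) = (k == p.2).
Proof.
apply/existsP/eqP => [[q /andP[/eqP/label_inj -> /eqP //]]|->].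
by exists p; rewrite !eqxx.
Qed.

Definition steps : seq (pred (anc d) * 'I_m * 'I_m) :=
  [seq (is_fst k, r0, k) | k <- enum 'I_m] ++ [seq (is_snd k, r1, k) | k <- enum 'I_m].

(** On a label, exactly one round for the first entry and one for the second entry fire. *)
Lemma steps_label D p (s : regs m D) :
  controlled_swaps t steps (label p) s = swap_regs r0 p.1 (swap_regs r1 p.2 s).
Proof.
have [uks mks] : uniq (enum 'I_m) /\ (forall k, k \in enum 'I_m).
  by split=> [|k]; rewrite ?enum_uniq ?mem_enum.
rewrite /controlled_swaps /steps; move: (enum 'I_m) uks mks => ks uks mks.
rewrite foldr_cat !foldr_map /=.
have -> : (fun k => controlled_swap t (is_fst k) r0 k (label p)) =
    (fun k (v : regs m D) => if k == p.1 then swap_regs r0 k v else v).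
  by apply/funext => k; apply/funext => v; rewrite controlled_swapE // is_fst_label.
have -> : (fun k => controlled_swap t (is_snd k) r1 k (label p)) =
    (fun k (v : regs m D) => if k == p.2 then swap_regs r1 k v else v).
  by apply/funext => k; apply/funext => v; rewrite controlled_swapE // is_snd_label.
by rewrite (foldr_only _ (i := p.1)) // (foldr_only _ (i := p.2)).
Qed.

(** Since [p.2] is not 0, the swap of [r1] and [p.2] leaves [r0] in place. *)
Lemma bring0 (p : 'I_m * 'I_m) : (p.1 < p.2)%N -> bring p r0 = p.1.
Proof.
move=> lp; rewrite /bring [tperm r1 _ _]tpermD ?tpermL //.
by apply/eqP => /(congr1 val) /= p20; rewrite p20 in lp.
Qed.

(** Since [p.2] is neither 0 nor [p.1], the swap of [r0] and [p.1] leaves it in place. *)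
Lemma bring1 (p : 'I_m * 'I_m) : (p.1 < p.2)%N -> bring p r1 = p.2.
Proof.
move=> lp; rewrite /bring tpermL tpermD //.
  by apply/eqP => /(congr1 val) /= p20; rewrite -p20 in lp.
by apply/eqP => /(congr1 val) /= p20; rewrite p20 ltnn in lp.
Qed.

Lemma pair_circuit :
  exists2 gs : seq (gate R d m), num_cswap gs = (m + m)%N &
    forall D (phi : 'I_m -> 'cV[C]_D), (forall i, normalized (phi i)) ->
      exists G : 'I_m * 'I_m -> 'cV[C]_#|regs (m - 2) D|,
        (forall p : 'I_m * 'I_m, (p.1 < p.2)%N -> normalized (G p)) /\
        circuit_mx D gs *m tens (ket R [ffun=> 0]) (prod_state phi)
        = (sqrtC (m * (m - 1) %/ 2)%:R)^-1 *:
          \sum_(p : 'I_m * 'I_m | (p.1 < p.2)%N)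
             tens (ket R (label p)) (pair_state hm (phi p.1) (phi p.2) (G p)).
Proof.
have [x [l lE]] : exists x l, [seq label p | p <- pairs] = x :: l.
  (* The pair of the first two registers guarantees a label [x] from which the superposition can
     start. *)
  have : (r0, r1) \in pairs by rewrite mem_enum.
  by case: pairs => // p ps _; exists (label p), [seq label p | p <- ps].
have ul : uniq (x :: l) by rewrite -lE map_inj_uniq ?enum_uniq.
have ml a : (a \in x :: l) = [exists p : 'I_m * 'I_m, (p.1 < p.2)%N && (a == label p)].
  rewrite -lE; apply/mapP/existsP => [[p]|[p /andP[pl /eqP ->]]].
    by rewrite mem_enum inE => pl ->; exists p; rewrite pl eqxx.
  by exists p; rewrite ?mem_enum.
have sl : (size l).+1 = (m * (m - 1) %/ 2)%N.
  by rewrite -[LHS]/(size (x :: l)) -lE size_map -card_ltn_pairs cardE.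
pose n := (m * (m - 1) %/ 2)%N.
have n0 : sqrtC n%:R != 0 :> C by rewrite sqrtC_eq0 pnatr_eq0 /n -sl.
have [F FR FE] := realizable_uniform R m t ul.
(* The transposition first moves all the amplitude from the zero string to [x]. *)
have [gs gs0 gsE] := realizable_comp (all_perm_realizable R m (tperm [ffun=> 0] x)) FR.
have [hs hsn hsE] := controlled_swaps_circuit R t steps.
exists (gs ++ hs).
  rewrite /num_cswap count_cat -/(num_cswap gs) -/(num_cswap hs) gs0 hsn.
  by rewrite /steps size_cat !size_map -enumT size_enum_ord.
move=> D phi phi1.
(* The garbage is the product of the input states that the two swaps leave beyond the first two
   registers. *)
exists (fun p => prod_state (fun l => phi (bring p (reg hm (rshift 2 l))))).
split=> [p _|]; first exact: prod_state_normalized.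
rewrite circuit_mx_cat -mulmxA.
have -> : tens (ket R [ffun=> 0]) (prod_state phi) =
    vec (fun y : conf d m D => (y.1 == [ffun=> 0])%:R * amplitude phi y.2).
  by apply/colP => k; rewrite tens_ketE !mxE enum_rankK.
rewrite gsE hsE; apply/colP => k; rewrite !mxE summxE /=.
under eq_bigr => p _ do rewrite tens_ketE.
case: (enum_val k : conf d m D) => a s /=; set s' := controlled_swaps _ _ _ _.
(* With the register content [s'] fixed, the amplitude at [x] is shared equally among the [n]
   labels. *)
rewrite (FE _ ((sqrtC n%:R)^-1 * amplitude phi s')); first last.
- move=> y yl; case: eqP => [yx|_]; last by rewrite mul0r.
  have : y = x by apply: (@perm_inj _ (tperm [ffun=> 0] x)); rewrite yx tpermR.
  by move=> {}yx; rewrite /= -yx yl in ul.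
- by rewrite tpermR eqxx mul1r sl mulrA divff // mul1r.
(* If [a] is a label, only its own summand survives; otherwise both sides vanish. *)
rewrite ml; case: existsP => [[p /andP[pl /eqP ap]]|np].
  rewrite (bigD1 p) //= ap eqxx mul1r big1 ?addr0 => [|q /andP[_ qp]]; last first.
    by rewrite (inj_eq label_inj) eq_sym (negbTE qp) mul0r.
  congr (_ * _); rewrite /s' ap steps_label !amplitude_swap.
  have := pair_stateE hm (fun r => phi (bring p r)) (enum_rank s).
  by rewrite -/r0 -/r1 bring0 // bring1 // enum_rankK => ->.
rewrite big1 ?mulr0 => [|p pl]; last first.
  by case: eqP => [ap|_]; [case: np; exists p; rewrite pl ap eqxx|rewrite mul0r].
case: eqP => [ax|_]; last by rewrite mul0r.
have ax' : a = x by apply: (@perm_inj _ (tperm [ffun=> 0] x)); rewrite ax tpermR.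
have : a \in x :: l by rewrite ax' mem_head.
by rewrite ml => /existsP.
Qed.

End PairCircuit.

(** * Labels of logarithmic length *)

Definition label_ancillas (m : nat) : nat := (2 * (trunc_log 2 m).+1)%N.

(** Each entry of a pair fits into [(trunc_log 2 m).+1] bits, because
    [m < 2 ^ (trunc_log 2 m).+1]. *)
Lemma card_pairs_le m :
  (#|{: 'I_m * 'I_m}| <= #|{: {ffun 'I_(label_ancillas m) -> 'I_2}}|)%N.
Proof.
rewrite card_prod card_ffun !card_ord /label_ancillas mulnC expnM mulnn.
by rewrite leq_sqr ltnW // trunc_log_ltn.
Qed.

(* Qubit 0 is reserved for the flag. *)
Definition pair_label (m : nat) (p : 'I_m * 'I_m) : anc (label_ancillas m).+1 :=
  [ffun q => if unlift ord0 q is Some q'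
             then enum_val (widen_ord (card_pairs_le m) (enum_rank p)) q' else 0].

Lemma pair_label_inj m : injective (@pair_label m).
Proof.
move=> p p' /ffunP pp; apply: enum_rank_inj.
have : widen_ord (card_pairs_le m) (enum_rank p) =
    widen_ord (card_pairs_le m) (enum_rank p').
  apply: enum_val_inj; apply/ffunP => q.
  by have := pp (lift ord0 q); rewrite !ffunE liftK.
by move=> /(congr1 val) /= /val_inj.
Qed.

Lemma pair_label_flag m (p : 'I_m * 'I_m) : pair_label p ord0 = 0.
Proof. by rewrite ffunE unlift_none. Qed.

Lemma label_ancillas_ln (R : realType) :
  (fun m : nat => (label_ancillas m).+1%:R : R) =O_\oo (fun m : nat => ln (m%:R : R)).
Proof.
apply/eqO_exP; have ln2 : 0 < ln (2 : R) by rewrite ln_gt0 // ltr1n.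
(* For [m >= 2], [L = trunc_log 2 m] is at least 1, so the count [2 * L + 3] is at most [5 * L],
   while [L * ln 2 <= ln m]. *)
exists (5 / ln 2); first by rewrite divr_gt0.
near=> m; have m2 : (2 <= m)%N by near: m; exact: nbhs_infty_ge.
have m0 : (0 < m)%N by exact: ltnW.
have tl1 : (1 <= trunc_log 2 m)%N by rewrite trunc_log_max.
have tl2 : (trunc_log 2 m)%:R * ln 2 <= ln m%:R :> R.
  rewrite mulrC mulr_natr -lnXn // ler_ln ?posrE ?exprn_gt0 ?ltr0n //.
  by rewrite -natrX ler_nat trunc_logP.
rewrite normr_nat ger0_norm ?ln_ge0 ?ler1n //.
rewrite mulrAC ler_pdivlMr //.
apply: le_trans (_ : 5 * ((trunc_log 2 m)%:R * ln 2) <= _).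
  by rewrite mulrA ler_pM2r // -natrM ler_nat /label_ancillas; lia.
by rewrite ler_pM2l.
Unshelve. all: by end_near. Qed.

Theorem lemma2p1 (R : realType) :
  exists (d : nat -> nat)
         (label : forall m : nat, 'I_m * 'I_m -> anc (d m))
         (U : forall m D : nat, 'M[R[i]]_#|conf (d m) m D|),
  [/\ forall (m : nat) (hm : (1 < m)%N),
        let n := (m * (m - 1) %/ 2)%N in
        {in [pred p : 'I_m * 'I_m | (p.1 < p.2)%N] &, injective (label m)} /\
        forall D : nat,
          U m D \is unitarymx /\
          forall phi : 'I_m -> 'cV[R[i]]_D,
            (forall i, normalized (phi i)) ->
            exists G : 'I_m * 'I_m -> 'cV[R[i]]_#|regs (m - 2) D|,
              (forall p : 'I_m * 'I_m, (p.1 < p.2)%N -> normalized (G p)) /\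
              U m D *m tens (ket R [ffun=> 0]) (prod_state phi)
              = (sqrtC n%:R)^-1 *:
                \sum_(p : 'I_m * 'I_m | (p.1 < p.2)%N)
                  tens (ket R (label m p))
                       (pair_state hm (phi p.1) (phi p.2) (G p)),
      (fun m : nat => (d m)%:R : R) =O_\oo (fun m : nat => ln (m%:R : R))
    & exists circ : forall m : nat, seq (gate R (d m) m),
        (forall m D : nat, (1 < m)%N -> circuit_mx D (circ m) = U m D) /\
        (fun m : nat => (num_cswap (circ m))%:R : R)
          =O_\oo (fun m : nat => m%:R : R)].
Proof.
(* One circuit per [m], chosen before [D] and the proof of [1 < m], so that choice yields a single
   family. *)
have circuits (m : nat) : exists gs : seq (gate R (label_ancillas m).+1 m),
    (num_cswap gs <= m + m)%N /\
    forall (hm : (1 < m)%N) D (phi : 'I_m -> 'cV[R[i]]_D),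
      (forall i, normalized (phi i)) ->
      exists G : 'I_m * 'I_m -> 'cV[R[i]]_#|regs (m - 2) D|,
        (forall p : 'I_m * 'I_m, (p.1 < p.2)%N -> normalized (G p)) /\
        circuit_mx D gs *m tens (ket R [ffun=> 0]) (prod_state phi)
        = (sqrtC (m * (m - 1) %/ 2)%:R)^-1 *:
          \sum_(p : 'I_m * 'I_m | (p.1 < p.2)%N)
             tens (ket R (pair_label p)) (pair_state hm (phi p.1) (phi p.2) (G p)).
  have [m_le1|hm] : (m <= 1)%N \/ (1 < m)%N by case: leqP; [left|right].
    (* With fewer than two registers the claim on states is vacuous. *)
    by exists [::]; split => // hm; exfalso; move: hm; rewrite ltnNge m_le1.
  have [gs gsn gsE] := pair_circuit R hm (@pair_label_inj m) (@pair_label_flag m).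
  exists gs; split => [|hm']; first by rewrite gsn.
  by have -> : hm' = hm := eq_irrelevance hm' hm.
pose circ m := sval (cid (circuits m)).
exists (fun m => (label_ancillas m).+1), pair_label, (fun m D => circuit_mx D (circ m)).
split.
- move=> m hm; split=> [p q _ _|D]; first exact: pair_label_inj.
  split=> [|phi phi1]; first exact: circuit_unitary.
  by have [_] := svalP (cid (circuits m)); apply.
- exact: label_ancillas_ln.
- exists circ; split => //; apply/eqO_exP; exists 2 => //.
  near=> m; rewrite !normr_nat -natrM ler_nat mul2n -addnn.
  by have [] := svalP (cid (circuits m)).
Unshelve. all: by end_near. Qed.
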